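(* The Truncated icosidodecahedron has Rupert's property.
   Context: A polyhedron $\mathbf{P}$ is a finite set of points of $\mathbb{R}^3$ (its vertices) in convex position and non-degenerate (not all contained in a plane); $\overline{\mathbf{P}}$ denotes its convex hull. A set with a hole is a subset of $\mathbb{R}^3$ whose interior is connected but not simply connected. $\mathbf{P}$ has Rupert's property (is Rupert) if there are a polyhedron $\mathbf{Q}$ of the same shape and size as (i.e. congruent to) $\mathbf{P}$ and a direction vector $v\in\mathbb{R}^3\setminus\{0\}$ such that $\overline{\mathbf{P}}\setminus\{q+tv: q\in\overline{\mathbf{Q}},\ t\in\mathbb{R}\}$ is a set with a hole. Notation: $T_{x,y}:\mathbb{R}^2\to\mathbb{R}^2$ is the translation by $(x,y)^t$; $R_\alpha:\mathbb{R}^2\to\mathbb{R}^2$ is the counter-clockwise rotation about the origin by the angle $\alpha$; and $M_{\theta,\varphi}:\mathbb{R}^3\to\mathbb{R}^2$ is the linear map with matrix $\begin{pmatrix}-\sin\theta&\cos\theta&0\\-\cos\theta\cos\varphi&-\sin\theta\cos\varphi&\sin\varphi\end{pmatrix}$. These maps act on sets elementwise. For a finite set $\mathcal{Q}\subset\mathbb{R}^2$, $\mathcal{Q}^\circ$ is the interior of its convex hull. Equivalently to the definition above, $\mathbf{P}$ is Rupert iff there are $x,y\in\mathbb{R}$, $\alpha,\theta_1,\theta_2\in[0,2\pi)$, $\varphi_1,\varphi_2\in[0,\pi]$ with $(T_{x,y}\circ R_\alpha\circ M_{\theta_1,\varphi_1})(\mathbf{P})\subset M_{\theta_2,\varphi_2}(\mathbf{P})^\circ$.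 Truncated icosidodecahedron: let $\Phi=(1+\sqrt5)/2$. Its vertices are all even permutations of the coordinates of the points (all sign choices) $(\pm\frac1\Phi,\pm\frac1\Phi,\pm(3+\Phi))$, $(\pm\frac2\Phi,\pm\Phi,\pm(1+2\Phi))$, $(\pm\frac1\Phi,\pm\Phi^2,\pm(-1+3\Phi))$, $(\pm(2\Phi-1),\pm2,\pm(2+\Phi))$ and $(\pm\Phi,\pm3,\pm2\Phi)$. *)

(* Defs.v *)
From HB Require Import structures.
From mathcomp Require Import all_boot all_order all_algebra all_fingroup.
From mathcomp Require Import all_classical all_reals all_analysis.
Set Implicit Arguments.
Unset Strict Implicit.
Unset Printing Implicit Defensive.
Import Order.TTheory GRing.Theory Num.Theory.
Import numFieldNormedType.Exports.

Local Open Scope classical_set_scope.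
Local Open Scope ring_scope.

Section Simply_connected.
Context {R : realType} {T : topologicalType}.
Implicit Types (A : set T) (x y : T) (g : R -> T).

Definition is_path_in A x y g : Prop :=
  [/\ {within `[0, 1], continuous g},
      forall t : R, t \in `[0, 1] -> A (g t),
      g 0 = x & g 1 = y].

Definition path_connected A : Prop :=
  forall x y, A x -> A y -> exists g, is_path_in A x y g.

(* The loop g based at x contracts to x inside A, the base point being kept
   fixed: H (s, t) is the loop parameter s at homotopy time t. *)
Definition null_homotopic_in A x g : Prop :=
  exists H : R * R -> T,
    [/\ {within `[0, 1] `*` `[0, 1], continuous H},
        forall s t : R, s \in `[0, 1] -> t \in `[0, 1] -> A (H (s, t)),
        forall s : R, s \in `[0, 1] -> H (s, 0) = g s,
        forall s : R, s \in `[0, 1] -> H (s, 1) = x &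
        forall t : R, t \in `[0, 1] -> H (0, t) = x /\ H (1, t) = x].

End Simply_connected.

Definition simply_connected (R : realType) (T : topologicalType)
    (A : set T) : Prop :=
  path_connected (R := R) A /\
  forall (x : T) (g : R -> T), is_path_in A x x g -> null_homotopic_in A x g.

Section Rupert.
Context {R : realType}.
Implicit Types (A P Q : set 'rV[R]_3) (u v : 'rV[R]_3).

Definition convex_hull A : set 'rV[R]_3 := smallest (@convex_set R 'rV[R]_3) A.

(* The library norm on 'rV[R]_3 is the sup norm (it only induces the same
   topology), so the Euclidean one is needed for congruence. *)
Definition euclidean_norm u : R := Num.sqrt (\sum_(i < 3) u 0 i ^+ 2).

Definition coplanar A : Prop :=
  exists n : 'rV[R]_3, exists c : R,
    n != 0 /\ forall u, A u -> \sum_(i < 3) n 0 i * u 0 i = c.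

(* A polyhedron is its vertex set; convex position means that no vertex lies in
   the convex hull of the others. *)
Definition polyhedron P : Prop :=
  [/\ finite_set P,
      forall p, P p -> ~ convex_hull (P `\ p) p &
      ~ coplanar P].

Definition congruent P Q : Prop :=
  exists f : 'rV[R]_3 -> 'rV[R]_3,
    (forall u v, euclidean_norm (f u - f v) = euclidean_norm (u - v)) /\
    Q = f @` P.

Definition has_hole A : Prop :=
  connected A° /\ ~ simply_connected R A°.

Definition tunnel Q v : set 'rV[R]_3 :=
  [set q + t *: v | q in convex_hull Q & t in [set: R]].

Definition Rupert P : Prop :=
  exists Q v,
    [/\ polyhedron Q, congruent P Q, v != 0 &
        has_hole (convex_hull P `\` tunnel Q v)].

End Rupert.

Section Truncated_icosidodecahedron.
Variable R : realType.

Definition golden_ratio : R := (1 + Num.sqrt 5) / 2.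

Local Notation Phi := golden_ratio.

Definition point3 (a b c : R) : 'rV[R]_3 := \row_(i < 3) [:: a; b; c]`_i.

Definition tid_base : seq 'rV[R]_3 :=
  [:: point3 (1 / Phi) (1 / Phi) (3 + Phi);
      point3 (2 / Phi) Phi (1 + 2 * Phi);
      point3 (1 / Phi) (Phi ^+ 2) (-1 + 3 * Phi);
      point3 (2 * Phi - 1) 2 (2 + Phi);
      point3 Phi 3 (2 * Phi)].

Definition truncated_icosidodecahedron : set 'rV[R]_3 :=
  [set v | exists (s : 'S_3) (e : 'I_3 -> bool) (p : 'rV[R]_3),
    [/\ ~~ odd_perm s, p \in tid_base &
        v = col_perm s (\row_(i < 3) ((-1) ^+ e i * p 0 i))]].

End Truncated_icosidodecahedron.

Arguments truncated_icosidodecahedron : clear implicits.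

(* Main.v *)
(* A rational rotation [rot] and a rational direction [axis] are chosen so that
   the shadow of the rotated polyhedron along [axis] lies strictly inside that
   of the original one; this is a finite list of inequalities in Q(sqrt 5),
   since the outer shadow is a centrally symmetric 30-gon and each of its edges
   bounds a linear functional on the rotated vertices.

   Let A be the interior of what remains of the hull K once the tunnel is
   removed, and let L be the slightly shrunk closed polygon in K that lies over
   the boundary of the shadow of K.  Each point of A is joined inside A by a
   segment to the point of L on the same ray from the origin of the shadow
   plane, so A is connected.  A contraction of L in A would project to a
   homotopy in the punctured plane; on a fine grid every small square has zero
   total crossing with a half-axis, hence so has L, whereas L crosses it once. *)

From HB Require Import structures.
Require Import Defs.
From mathcomp Require Import all_boot all_order all_algebra all_fingroup.
From mathcomp Require Import all_classical all_reals all_analysis.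
From mathcomp Require Import ring lra zify ssrZ.
Set Implicit Arguments.
Unset Strict Implicit.
Unset Printing Implicit Defensive.
Import Order.TTheory GRing.Theory Num.Theory.
Import numFieldNormedType.Exports.
Local Open Scope classical_set_scope.
Local Open Scope ring_scope.

(** * Winding numbers on a grid *)

Section Winding.
Context {R : realType}.
Implicit Types (a b : R * R) (S : set (R * R)).

(* For a short step from [a] to [b], the signed crossing of the half-axis
   [z.2 = 0 < z.1]; summed over a fine closed polygon that avoids the origin it
   is the winding number. *)
Definition crossing a b : int :=
  if (0 < a.1) && (0 < b.1) then (0 <= b.2)%R%:Z - (0 <= a.2)%R%:Z else 0.

(** On each of these half-planes [crossing] is the difference of one function at the two ends, so
    nothing can wind there. *)
Definition one_sided S : Prop :=
  [\/ S `<=` [set z | 0 < z.1], S `<=` [set z | z.1 < 0],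
      S `<=` [set z | 0 < z.2] | S `<=` [set z | z.2 < 0]].

Lemma one_sidedS S S' : S `<=` S' -> one_sided S' -> one_sided S.
Proof.
by move=> SS' [] h; [constructor 1|constructor 2|constructor 3|constructor 4];
  exact: subset_trans h.
Qed.

Lemma crossing_xx a : crossing a a = 0.
Proof. by rewrite /crossing subrr if_same. Qed.

Lemma crossing_eq0 S a b : one_sided S -> ~ S `<=` [set z | 0 < z.1] ->
  S a -> S b -> crossing a b = 0.
Proof.
rewrite /crossing => -[] h Sn /h /= ha /h /= hb //.
- by rewrite ltNge (ltW ha).
- by rewrite !ltW ?subrr ?if_same.
- by rewrite !leNgt ha hb subrr if_same.
Qed.

(** On the right half-plane both sums telescope to the same difference; on the other three every
    term is zero. *)
Lemma crossing_square S a b c d : one_sided S -> S a -> S b -> S c -> S d ->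
  crossing a b + crossing b d = crossing a c + crossing c d.
Proof.
move=> oS Sa Sb Sc Sd.
have [h|h] := pselect (S `<=` [set z | 0 < z.1]); last first.
  by rewrite !(crossing_eq0 oS h).
have /= ha := h _ Sa; have /= hb := h _ Sb.
have /= hc := h _ Sc; have /= hd := h _ Sd.
by rewrite /crossing ha hb hc hd /=; ring.
Qed.

(** Discrete Green formula: the relations of the small squares add up to that of the whole
    rectangle. *)
Lemma crossing_grid (g : nat -> nat -> R * R) m n :
  (forall i j, (i < m)%N -> (j < n)%N ->
    crossing (g i j) (g i.+1 j) + crossing (g i.+1 j) (g i.+1 j.+1) =
    crossing (g i j) (g i j.+1) + crossing (g i j.+1) (g i.+1 j.+1)) ->
  \sum_(i < m) crossing (g i 0%N) (g i.+1 0%N)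
    + \sum_(j < n) crossing (g m j) (g m j.+1) =
  \sum_(j < n) crossing (g 0%N j) (g 0%N j.+1)
    + \sum_(i < m) crossing (g i n) (g i.+1 n).
Proof.
elim: m => [|m IHm] gE.
  by rewrite !big_ord0 add0r addr0.
rewrite !big_ord_recr /=.
have -> : \sum_(j < n) crossing (g m.+1 j) (g m.+1 j.+1) =
    \sum_(j < n) crossing (g m j) (g m j.+1) + crossing (g m n) (g m.+1 n)
    - crossing (g m 0%N) (g m.+1 0%N).
  have gmE j : (j < n)%N -> _ := gE m j (leqnn _).
  elim: n gmE {IHm gE} => [|n IHn] gmE.
    by rewrite !big_ord0 add0r subrr.
  rewrite !big_ord_recr /= IHn => [|j jn]; last by apply: gmE; rewrite ltnW.
  have := gmE n (leqnn _); lra.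
have := IHm (fun i j im => gE i j (ltnW im)); lra.
Qed.

(** The four open half-planes cover the punctured plane. *)
Lemma one_sided_nbhs a : a <> (0, 0) -> exists2 S, nbhs a S & one_sided S.
Proof.
have open_fst (U : set R) : open U -> open [set z : R * R | U z.1].
  by move=> oU; apply: open_comp => // ? _; exact: cvg_fst.
have open_snd (U : set R) : open U -> open [set z : R * R | U z.2].
  by move=> oU; apply: open_comp => // ? _; exact: cvg_snd.
case: a => x y xy0.
have [x0|x0|x0] := ltgtP 0 x.
- exists [set z | 0 < z.1]; last by constructor 1.
  by apply: open_nbhs_nbhs; split => //; exact: (open_fst _ (open_gt (y := 0))).
- exists [set z | z.1 < 0]; last by constructor 2.
  by apply: open_nbhs_nbhs; split => //; exact: (open_fst _ (open_lt (y := 0))).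
have [y0|y0|y0] := ltgtP 0 y; last by rewrite -x0 -y0 in xy0.
- exists [set z | 0 < z.2]; last by constructor 3.
  by apply: open_nbhs_nbhs; split => //; exact: (open_snd _ (open_gt (y := 0))).
- exists [set z | z.2 < 0]; last by constructor 4.
  by apply: open_nbhs_nbhs; split => //; exact: (open_snd _ (open_lt (y := 0))).
Qed.

(** Lebesgue number lemma for the cover of [K] by the preimages of the four half-planes. *)
Lemma lebesgue_one_sided (T : pseudoMetricType R) (K : set T) (f : T -> R * R) :
  compact K -> {within K, continuous f} -> (forall x, K x -> f x <> (0, 0)) ->
  exists2 e, 0 < e & forall x, K x -> one_sided [set f y | y in K `&` ball x e].
Proof.
move=> /compact_near_coveringP cK /subspace_continuousP cf f0.
have : \forall e \near (0 : R)^'+, K `<=`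
    [set x | one_sided [set f y | y in K `&` ball x e]].
  apply: cK => x Kx.
  have [S nS oS] := one_sided_nbhs (f0 x Kx).
  have /nbhs_ballP[d /= d0 dS] := cf x Kx _ nS.
  exists (ball x (d / 2), [set e | e < d / 2]) => /=.
    split; first by apply: nbhsx_ballx; rewrite divr_gt0.
    by apply: nbhs_right_lt; rewrite divr_gt0.
  move=> [x' e] /= [xx' ed]; apply: (one_sidedS _ oS) => _ [y [Ky x'y] <-].
  apply: dS => //; rewrite [d]splitr; apply: (ball_triangle xx').
  exact: le_ball (ltW ed) _ x'y.
move=> /(filterI (nbhs_right_gt _)) /filter_ex[e [e0 eP]].
by exists e.
Qed.

(** Once the mesh is below the Lebesgue number of [p \o H], the grid formula applies. Three sides of
    the square are sent to [p x] and contribute zero, hence so does the side carrying [g]. *)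
Lemma null_homotopic_crossing (T : topologicalType) (A : set T)
    (p : T -> R * R) (x : T) (g : R -> T) :
  continuous p -> (forall y, A y -> p y <> (0, 0)) ->
  null_homotopic_in A x g ->
  exists N : nat, forall n, (N <= n)%N ->
    \sum_(i < n) crossing (p (g (i%:R / n%:R))) (p (g (i.+1%:R / n%:R))) = 0.
Proof.
move=> cp p0 [H [cH AH H0 H1 Hx]].
have [] := @lebesgue_one_sided _ (`[0, 1] `*` `[0, 1] : set (R * R)) (p \o H).
- by apply: compact_setX; exact: segment_compact.
- by apply: within_continuous_comp cH => y _; exact: cp.
- move=> [s t] [/= s01 t01]; exact/p0/AH.
move=> e e0 eP.
exists (Num.bound e^-1).+1 => n nN.
have n0 : (0 < n)%N by apply: leq_trans nN.
have n0R : 0 < n%:R :> R by rewrite ltr0n.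
have ne : n%:R^-1 < e.
  rewrite invf_plt ?posrE//; apply: lt_le_trans (archi_boundP _) _.
    by rewrite invr_ge0 ltW.
  by rewrite ler_nat ltnW.
have frac01 i : (i <= n)%N -> (i%:R / n%:R : R) \in `[0, 1].
  move=> i_n; rewrite in_itv /= divr_ge0 ?ler0n//=.
  by rewrite ler_pdivrMr// mul1r ler_nat.
have frac_near i (b : bool) : `|i%:R / n%:R - (i + b)%:R / n%:R : R| < e.
  rewrite -mulrBl natrD opprD addrA subrr sub0r mulNr normrN.
  case: b; first by rewrite mul1r gtr0_norm ?invr_gt0.
  by rewrite mul0r normr0.
pose q i j := p (H (i%:R / n%:R, j%:R / n%:R)).
(* The product distance is a maximum, so [S i j] contains the images of all four corners of its grid
   square. *)
pose S i j := [set (p \o H) z | z in (`[0, 1] `*` `[0, 1]) `&`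
  ball ((i%:R / n%:R, j%:R / n%:R) : R * R) e].
have mem i j (a b : bool) : (i < n)%N -> (j < n)%N ->
    S i j (q (i + a)%N (j + b)%N).
  move=> i_n j_n; exists ((i + a)%:R / n%:R, (j + b)%:R / n%:R) => //.
  split; last by split; rewrite -ball_normE /=; exact: frac_near.
  split; apply: frac01.
    by case: a; rewrite ?addn1 ?addn0 // ltnW.
  by case: b; rewrite ?addn1 ?addn0 // ltnW.
have := @crossing_grid q n n.
have q_const i j k l : q i j = p x -> q k l = p x ->
    crossing (q i j) (q k l) = 0.
  by move=> -> ->; exact: crossing_xx.
have nn1 : n%:R / n%:R = 1 :> R by rewrite divff// gt_eqF.
have q0 j : (j <= n)%N -> q 0%N j = p x.
  by move=> jn; rewrite /q mul0r; have [-> _] := Hx _ (frac01 _ jn).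
have qn j : (j <= n)%N -> q n j = p x.
  by move=> jn; rewrite /q nn1; have [_ ->] := Hx _ (frac01 _ jn).
have qt i : (i <= n)%N -> q i n = p x.
  by move=> i_n; rewrite /q nn1 H1// frac01.
have qb i : (i <= n)%N -> q i 0%N = p (g (i%:R / n%:R)).
  by move=> i_n; rewrite /q mul0r H0// frac01.
rewrite (eq_bigr (fun i : 'I_n => crossing (p (g (i%:R / n%:R)))
    (p (g (i.+1%:R / n%:R))))); last by move=> i _; rewrite !qb// ltnW.
rewrite [X in _ + X]big1 => [|j _]; last by rewrite q_const ?qn// ltnW.
rewrite [X in _ = X + _]big1 => [|j _]; last by rewrite q_const ?q0// ltnW.
rewrite [X in _ = _ + X]big1 => [|i _]; last by rewrite q_const ?qt// ltnW.
rewrite !addr0; apply => i j i_n j_n.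
apply: (crossing_square (eP (i%:R / n%:R, j%:R / n%:R) _)).
- by split; apply: frac01; rewrite ltnW.
- by have := mem i j false false i_n j_n; rewrite !addn0.
- by have := mem i j true false i_n j_n; rewrite addn1 addn0.
- by have := mem i j false true i_n j_n; rewrite addn1 addn0.
- by have := mem i j true true i_n j_n; rewrite !addn1.
Qed.

End Winding.

(** * Closed polygons *)

Section Polyline.
Context {R : realType} {V : normedModType R}.
Implicit Types (w : nat -> V) (s r : R) (N : nat).

Definition clamp01 (x : R) : R := Num.max 0 (Num.min 1 x).

Lemma clamp01_continuous : continuous clamp01.
Proof.
move=> x.
have cmin : {for x, continuous ((fun=> 1 : R^o) \min id)}.
  by apply: continuous_min => //; exact: cvg_cst.
have := @continuous_max _ _ (fun=> 0) _ x _ cmin.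
by apply; exact: cvg_cst.
Qed.

(** The weight of edge [i] rises from 0 to 1 while [N * s] runs from [i] to [i + 1]. With one global
    formula, continuity requires no gluing of edges. *)
Definition polyline w N s : V :=
  w 0%N + \sum_(i < N) clamp01 (N%:R * s - i%:R) *: (w i.+1 - w i).

Lemma polyline_continuous w N : continuous (polyline w N).
Proof.
move=> s; apply: cvgD; first exact: cvg_cst.
apply: (cvg_big add_continuous) => i _; apply: cvgZr_tmp.
have affine : {for s, continuous (fun t : R => N%:R * t - i%:R : R)}.
  apply: cvgB; last exact: cvg_cst.
  by apply: cvgM; [exact: cvg_cst|exact: cvg_id].
have := @continuous_comp R R R (fun t : R => N%:R * t - i%:R : R) clamp01 s
  affine.
by apply; exact: clamp01_continuous.
Qed.

(** Earlier edges have weight 1 and telescope to [w i - w 0], edge [i] has weight [r], later edges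
    have weight 0. *)
Lemma polylineE w N i r : (i < N)%N -> 0 <= r <= 1 ->
  polyline w N ((i%:R + r) / N%:R) = (1 - r) *: w i + r *: w i.+1.
Proof.
move=> iN /andP[r0 r1].
have N0 : N%:R != 0 :> R by rewrite pnatr_eq0 -lt0n (leq_trans _ iN).
rewrite /polyline mulrC divfK// -(big_mkord predT (fun j =>
  clamp01 (i%:R + r - j%:R) *: (w j.+1 - w j))).
rewrite (big_cat_nat (n := i)) ?(ltnW iN)//.
rewrite [X in _ + (_ + X)]big_ltn//.
rewrite (eq_big_nat _ _ (F2 := fun j => w j.+1 - w j)); last first.
  move=> j /andP[_ ji]; rewrite /clamp01 min_l ?max_r ?ler01 ?scale1r//.
  have : j.+1%:R <= i%:R :> R by rewrite ler_nat.
  rewrite -natr1; lra.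
rewrite telescope_sumr// big1_seq => [|j /andP[_]]; last first.
  rewrite mem_index_iota => /andP[ij _]; rewrite /clamp01.
  have : i.+1%:R <= j%:R :> R by rewrite ler_nat.
  rewrite -natr1 => ij'; rewrite min_r; last lra.
  rewrite max_l ?scale0r//; lra.
have -> : clamp01 (i%:R + r - i%:R) = r.
  by rewrite /clamp01 addrC addKr min_r// max_r.
rewrite [X in _ + (_ + X)]addr0 addrA (addrC (w 0%N)) subrK.
rewrite scalerBr scalerBl scale1r.
by rewrite -!addrA; congr (_ + _); rewrite addrC.
Qed.

Lemma itv01_frac N s : (0 < N)%N -> s \in `[0, 1] ->
  exists i r, [/\ (i < N)%N, 0 <= r <= 1 & s = (i%:R + r) / N%:R].
Proof.
rewrite in_itv /= => N0 /andP[s0 s1].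
have N0R : 0 < N%:R :> R by rewrite ltr0n.
have [s1'|s1'] := ltP s 1.
  have Ns0 : 0 <= N%:R * s by rewrite mulr_ge0// ltW.
  have /andP[lo hi] := truncn_itv Ns0.
  exists (Num.truncn (N%:R * s)), (N%:R * s - (Num.truncn (N%:R * s))%:R).
  split.
  - by rewrite -(ltr_nat R); apply: le_lt_trans lo _; rewrite gtr_pMr.
  - rewrite subr_ge0 lo /= lerBlDr; move: hi; rewrite -natr1; lra.
  - by rewrite addrC subrK mulrC mulKf// gt_eqF.
(* At [s = 1] truncation would give the index [N], so the last edge is taken with [r = 1]. *)
exists N.-1, 1; rewrite ler01 lexx prednK//; split => //.
by rewrite natr1 prednK// divff ?gt_eqF//; lra.
Qed.

Lemma crossing_upper (a b : R * R) : 0 < a.2 -> 0 < b.2 -> crossing a b = 0.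
Proof. by move=> a0 b0; rewrite /crossing !ltW ?subrr ?if_same. Qed.

Lemma crossing_lower (a b : R * R) : a.2 < 0 -> b.2 < 0 -> crossing a b = 0.
Proof. by move=> a0 b0; rewrite /crossing !leNgt a0 b0 subrr if_same. Qed.

Lemma crossing_left (a b : R * R) : a.1 < 0 -> crossing a b = 0.
Proof. by move=> a0; rewrite /crossing ltNge ltW. Qed.

Lemma conv_gt0 (f : {scalar V}) (x y : V) r : 0 < f x -> 0 < f y ->
  0 <= r <= 1 -> 0 < f ((1 - r) *: x + r *: y).
Proof.
move=> fx fy /andP[r0 r1]; rewrite linearD !linearZ /=.
have [->|r_neq1] := eqVneq r 1; first by rewrite subrr mul0r add0r mul1r.
have : 0 < (1 - r) * f x by rewrite mulr_gt0// subr_gt0 lt_neqAle r_neq1.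
have : 0 <= r * f y by rewrite mulr_ge0// ltW.
lra.
Qed.

(** By antipodal symmetry only edges 0 and [h] change sides of the first axis, and edge [h] does so
    on the left. Edge 0 passes upwards on the right, which gives 1. As [n] is a multiple of [h.*2],
    every vertex is a sample point. *)
Lemma crossing_polyline (f1 f2 : {scalar V}) w h m :
  let p x := (f1 x, f2 x) in let n := (h.*2 * m)%N in
  (0 < m)%N -> (forall i, w (i + h)%N = - w i) ->
  0 < f1 (w 0%N) -> 0 < f1 (w 1%N) -> f2 (w 0%N) < 0 ->
  (forall i, (0 < i < h)%N -> 0 < f2 (w i)) ->
  \sum_(k < n) crossing (p (polyline w h.*2 (k%:R / n%:R)))
    (p (polyline w h.*2 (k.+1%:R / n%:R))) = 1.
Proof.
move=> p n m0 wN f1w0 f1w1 f2w0 f2w.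
have h0 : (0 < h)%N.
  rewrite lt0n; apply/eqP => h_eq0; have := congr1 f1 (wN 0%N).
  by rewrite h_eq0 raddfN; lra.
have f1wh : f1 (w h) < 0 by rewrite -[h]add0n wN raddfN oppr_lt0.
have f2wh : 0 < f2 (w h) by rewrite -[h]add0n wN raddfN oppr_gt0.
have h1 : (1 < h)%N.
  rewrite ltn_neqAle h0 andbT; apply: contraTneq f1w1 => ->.
  by rewrite -leNgt ltW.
pose q k := p (polyline w h.*2 (k%:R / n%:R)).
have mR : 0 < m%:R :> R by rewrite ltr0n.
have hR : 0 < h.*2%:R :> R by rewrite ltr0n double_gt0.
have itv_frac (r : nat) : (r <= m)%N -> 0 <= r%:R / m%:R <= (1 : R).
  by move=> rm; rewrite divr_ge0 ?ler0n//= ler_pdivrMr// mul1r ler_nat.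
have qE i (r : nat) : (i < h.*2)%N -> (r <= m)%N ->
    q (i * m + r)%N = p ((1 - r%:R / m%:R) *: w i + (r%:R / m%:R) *: w i.+1).
  move=> ih rm; rewrite /q -(polylineE w ih) ?itv_frac//.
  congr (p (polyline _ _ _)); rewrite /n natrD !natrM.
  by field; rewrite !gt_eqF.
have edge_gt0 (f : {scalar V}) i (r : nat) : 0 < f (w i) -> 0 < f (w i.+1) ->
    (r <= m)%N -> 0 < f ((1 - r%:R / m%:R) *: w i + (r%:R / m%:R) *: w i.+1).
  by move=> fi fi1 rm; apply: conv_gt0 => //; exact: itv_frac.
have edge_lt0 (f : {scalar V}) i (r : nat) : f (w i) < 0 -> f (w i.+1) < 0 ->
    (r <= m)%N -> f ((1 - r%:R / m%:R) *: w i + (r%:R / m%:R) *: w i.+1) < 0.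
  move=> fi fi1 rm; rewrite -oppr_gt0.
  have := @conv_gt0 (\- f) (w i) (w i.+1) (r%:R / m%:R).
  by apply; rewrite /= ?oppr_gt0//; exact: itv_frac.
rewrite -(big_mkord predT (fun k => crossing (q k) (q k.+1))).
have mn : (m <= n)%N by rewrite leq_pmull// double_gt0.
(* The first [m] steps run along edge 0; all later ones contribute zero. *)
rewrite (big_cat_nat (n := m))//= [X in _ + X]big1_seq ?addr0; last first.
  move=> k /andP[_]; rewrite mem_index_iota => /andP[mk kn].
  have km : (k %% m < m)%N by rewrite ltn_mod.
  have kh : (k %/ m < h.*2)%N by rewrite ltn_divLR.
  have k0 : (0 < k %/ m)%N by rewrite divn_gt0.
  rewrite (divn_eq k m) -addnS !qE// 1?ltnW//.
  move: (k %/ m)%N (k %% m)%N km kh k0 => i r rm ih i0.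
  have [i_h|h_i|->] := ltngtP i h.
  - apply: crossing_upper; apply: edge_gt0 => //; try exact: ltnW;
      try by apply: f2w; rewrite i0.
    + by move: i_h; rewrite leq_eqVlt => /orP[/eqP->//|ih1]; rewrite f2w.
    + by move: i_h; rewrite leq_eqVlt => /orP[/eqP->//|ih1]; rewrite f2w.
  - have lo j : (h < j < h.*2.+1)%N -> f2 (w j) < 0.
      move=> /andP[hj j2h]; rewrite -(subnK (ltnW hj)) wN raddfN oppr_lt0.
      have [->|jh] := eqVneq j h.*2; first by rewrite -addnn addnK.
      by apply: f2w; lia.
    apply: crossing_lower; apply: edge_lt0 => //; try exact: ltnW;
      by apply: lo; lia.
  - apply: crossing_left; apply: edge_lt0 => //; try exact: ltnW.
    by rewrite -[h]add0n -addSn wN raddfN oppr_lt0.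
have q1gt0 k : (k <= m)%N -> 0 < (q k).1.
  move=> km; rewrite -[k]add0n -(mul0n m) qE ?double_gt0//.
  exact: edge_gt0.
rewrite (eq_big_nat _ _
  (F2 := fun k => (0 <= (q k.+1).2)%R%:Z - (0 <= (q k).2)%R%:Z));
  last by move=> k /andP[_ km]; rewrite /crossing !q1gt0// ltnW.
rewrite (telescope_sumr (fun k => (0 <= (q k).2)%R%:Z))//.
have -> : q 0%N = p (w 0%N).
  by rewrite -[0%N](mul0n m) -[(0 * m)%N]addn0 qE ?double_gt0// mul0r subr0
    scale1r scale0r addr0.
have -> : q m = p (w 1%N).
  by rewrite -[m in q m]mul1n -[(1 * m)%N]addn0 qE// ?mul0r ?subr0
    ?scale1r ?scale0r ?addr0// -addnn ltn_addr.
by rewrite /= (leNgt 0 (f2 (w 0%N))) f2w0 ltW// f2w.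
Qed.

End Polyline.

(** * Convex bodies with a tunnel *)

Section Convex.
Context {R : realType} {V : normedModType R}.
Implicit Types (A : set V) (x y : V) (t : R).

Lemma convex_setP A : convex_set A <-> (forall x y t, A x -> A y ->
  0 <= t <= 1 -> A ((1 - t) *: x + t *: y)).
Proof.
split=> [cA x y t Ax Ay /andP[t0 t1]|cA x y t /set_mem Ax /set_mem Ay].
  have := cA y x (Itv01 t0 t1) (mem_set Ay) (mem_set Ax).
  by move=> /set_mem; rewrite /conv /= addrC.
apply/mem_set; rewrite /conv /= addrC.
by apply: cA => //; rewrite ge0 le1.
Qed.

(** Moving both end points by the same small vector moves their combination by that vector. *)
Lemma convex_interior A : convex_set A -> convex_set A°.
Proof.
move=> /convex_setP cA; apply/convex_setP => x y t.
move=> /nbhs_ballP[d /= d0 dA] /nbhs_ballP[e /= e0 eA] t01.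
apply/nbhs_ballP; exists (Num.min d e); first by rewrite /= lt_min d0.
move=> z; rewrite -ball_normE /= lt_min => /andP[zd ze].
have [u zE] : exists u, z = (1 - t) *: x + t *: y + u.
  by exists (z - ((1 - t) *: x + t *: y)); rewrite addrC subrK.
have ball_u (s : R) (a : V) :
    `|(1 - t) *: x + t *: y - z| < s -> ball a s (a + u).
  rewrite zE -ball_normE /= (opprD _ u) addrA subrr sub0r.
  by rewrite (opprD a) addrA subrr sub0r.
have -> : z = (1 - t) *: (x + u) + t *: (y + u).
  by rewrite !scalerDr addrACA -scalerDl subrK scale1r.
by apply: cA => //; [apply: dA|apply: eA]; exact: ball_u.
Qed.

End Convex.

(** * A criterion for a tunnel to leave a set with a hole *)

Section Criterion.
Context {R : realType}.
Local Notation V := 'rV[R]_3.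
(** [(f1, f2)] is the projection along [v] to the shadow plane; the tunnel is drilled through [K] by
    [C]. *)
Variables (K C : set V) (v : V) (f1 f2 : {scalar V}).
Hypotheses (cK : convex_set K) (cC : convex_set C).
Hypotheses (C0 : C 0) (CN : forall x, C x -> C (- x)).
Hypotheses (f1_cont : continuous f1) (f2_cont : continuous f2).
Hypotheses (f1v : f1 v = 0) (f2v : f2 v = 0).
Hypothesis ker_f : forall x, f1 x = 0 -> f2 x = 0 -> exists t, x = t *: v.
Variables (h : nat) (w : nat -> V).
Hypotheses (wN : forall i, w (i + h)%N = - w i) (Kw : forall i, K° (w i)).
(** [g] factors through the shadow, where it separates a whole edge of the loop from the shadow of
    [C]. *)
Hypothesis w_out : forall i, (i < h)%N -> exists (g : {scalar V}) (c : R),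
  [/\ continuous g, g v = 0, forall q, C q -> g q <= c, c < g (w i) &
      c < g (w i.+1)].
(** The vertices turn counter-clockwise around the origin of the shadow. *)
Hypothesis w_turn : forall i, (i < h)%N ->
  0 < f1 (w i) * f2 (w i.+1) - f2 (w i) * f1 (w i.+1).
Hypotheses (f1w0 : 0 < f1 (w 0%N)) (f1w1 : 0 < f1 (w 1%N)).
Hypotheses (f2w0 : f2 (w 0%N) < 0).
Hypothesis f2w : forall i, (0 < i < h)%N -> 0 < f2 (w i).

Let T := [set q + t *: v | q in C & t in [set: R]].
Let O := (~` T)°.
Let edge i r : V := (1 - r) *: w i + r *: w i.+1.

Lemma h_gt0 : (0 < h)%N.
Proof.
rewrite lt0n; apply/eqP => h_eq0; have := congr1 f1 (wN 0%N).
by rewrite h_eq0 raddfN; move: f1w0; lra.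
Qed.

(** [x] and [t *: q] have the same shadow, so they differ by a multiple of [v], and [t *: q] lies in
    [C]. *)
Lemma tunnel_kernel x q t : C q -> f1 x = t * f1 q -> f2 x = t * f2 q ->
  0 <= t <= 1 -> T x.
Proof.
move=> Cq xq1 xq2 t01.
have [s xE] : exists s, x - t *: q = s *: v.
  by apply: ker_f; rewrite linearB linearZ /= (xq1, xq2) subrr.
exists (t *: q); last by exists s => //; rewrite -xE addrC subrK.
have /convex_setP := cC => /(_ 0 q t C0 Cq t01).
by rewrite scaler0 add0r.
Qed.

Lemma tunnelN x : T x -> T (- x).
Proof.
move=> [q Cq [t _ <-]]; exists (- q); first exact: CN.
by exists (- t) => //; rewrite opprD scaleNr.
Qed.

(* The shadow of [C] is star-shaped around 0. *)
Lemma outside_starred x z s : O x -> f1 z = s * f1 x -> f2 z = s * f2 x ->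
  1 <= s -> O z.
Proof.
move=> /nbhs_ballP[e /= e0 xe] zx1 zx2 s1.
have s0 : 0 < s by lra.
apply/nbhs_ballP; exists e => //= z' zz' [q Cq [t _ z'E]].
(* This point is in the ball around [x] because [s^-1 <= 1], yet its shadow is [s^-1] times that of
   [q], which puts it in the tunnel. *)
apply: (xe (x + s^-1 *: (z' - z))).
  rewrite -ball_normE /= opprD addrA subrr sub0r normrN normrZ.
  rewrite gtr0_norm ?invr_gt0// distrC.
  move: zz'; rewrite -ball_normE /=; apply: le_lt_trans.
  by rewrite ler_piMl// invf_le1.
apply: (@tunnel_kernel _ q s^-1) => //; rewrite ?invr_ge0 ?invf_le1 ?(ltW s0)//.
- rewrite linearD linearZ linearB /= -z'E linearD linearZ /= f1v zx1.
  by field; rewrite gt_eqF.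
- rewrite linearD linearZ linearB /= -z'E linearD linearZ /= f2v zx2.
  by field; rewrite gt_eqF.
Qed.

Lemma outsideN x : O x -> O (- x).
Proof.
move=> /nbhs_ballP[e /= e0 xe]; apply/nbhs_ballP; exists e => //= z xz Tz.
apply: (xe (- z)); last exact: tunnelN.
by move: xz; rewrite -!ball_normE /= opprK -opprD normrN.
Qed.

Lemma edgeN i r : edge (i + h) r = - edge i r.
Proof. by rewrite /edge -addSn !wN !scalerN -opprD. Qed.

Lemma edgeE (f : {scalar V}) i r :
  f (edge i r) = (1 - r) * f (w i) + r * f (w i.+1).
Proof. by rewrite /edge linearD !linearZ. Qed.

(** The separating functional exceeds its bound along the whole edge, and its strict superlevel set
    is open and misses the tunnel. Edges from [h] on follow by symmetry. *)
Lemma edge_out i r : (i < h.*2)%N -> 0 <= r <= 1 -> O (edge i r).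
Proof.
wlog ih : i / (i < h)%N => [hw i2h r01|_ /andP[r0 r1]].
  have [ih|hi] := ltnP i h; first exact: hw.
  rewrite -(subnK hi) edgeN; apply: outsideN; apply: hw => //; lia.
have [g [c [g_cont gv Cc wc wc']]] := w_out ih.
have g_open : open (g @^-1` [set s | c < s]).
  by apply: open_comp => [x _|]; [exact: g_cont|exact: open_gt].
have cE : c < g (edge i r).
  rewrite -subr_gt0 edgeE.
  have : 0 <= (1 - r) * (g (w i) - c) by rewrite mulr_ge0 ?subr_ge0// ltW.
  have [->|r_neq1] := eqVneq r 1; first by lra.
  have : 0 < (1 - r) * (g (w i) - c).
    by rewrite mulr_gt0 ?subr_gt0// lt_neqAle r_neq1.
  have : 0 <= r * (g (w i.+1) - c) by rewrite mulr_ge0// subr_ge0 ltW.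
  lra.
apply: filterS (open_nbhs_nbhs (conj g_open cE)).
move=> x /= cx [q Cq [t _ xE]]; have := Cc _ Cq.
rewrite leNgt => /negP; apply; move: cx.
by rewrite -xE linearD linearZ /= gv mulr0 addr0.
Qed.

Lemma edge_in i r : 0 <= r <= 1 -> K° (edge i r).
Proof.
by move=> r01; have /convex_setP := convex_interior cK; apply.
Qed.

Lemma sign_change (c : nat -> R) n : (0 < n)%N -> 0 <= c 0%N -> c n <= 0 ->
  exists i, [/\ (i < n)%N, 0 <= c i & c i.+1 <= 0].
Proof.
elim: n => // -[_ _ c0 c1|n IHn _ c0 cn]; first by exists 0%N.
have [cn1|cn1] := leP 0 (c n.+1); first by exists n.+1.
have [//||i [ni ci ci1]] := IHn _ c0; first exact: ltW.
by exists i; rewrite ltnS ltnW.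
Qed.

Lemma pi_neq0 x : O x -> f1 x <> 0 \/ f2 x <> 0.
Proof.
move=> /nbhs_singleton Ox; apply/not_andP => -[x1 x2]; apply: Ox.
by apply: (@tunnel_kernel _ 0 0) => //; rewrite ?linear0 ?mulr0 ?lexx ?ler01.
Qed.

(** [c x i] is the cross product of the shadows of [w i] and [x]. It changes sign within half a
    turn, since [w h = - w 0], and this locates the edge that the ray of [x] meets. *)
Lemma sector x : f1 x <> 0 \/ f2 x <> 0 -> exists i r s,
  [/\ (i < h.*2)%N, 0 <= r <= 1, 0 < s,
      f1 (edge i r) = s * f1 x & f2 (edge i r) = s * f2 x].
Proof.
pose c x i := f1 (w i) * f2 x - f2 (w i) * f1 x.
suff sector_half y : 0 <= c y 0%N -> f1 y <> 0 \/ f2 y <> 0 ->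
    exists i r s, [/\ (i < h)%N, 0 <= r <= 1, 0 < s,
      f1 (edge i r) = s * f1 y & f2 (edge i r) = s * f2 y].
  move=> x0; have [c0|c0] := leP 0 (c x 0%N).
    have [i [r [s [ih r01 s0 e1 e2]]]] := sector_half x c0 x0.
    by exists i, r, s; split => //; rewrite -addnn ltn_addr.
  have [||i [r [s [ih r01 s0 e1 e2]]]] := sector_half (- x).
  - by move: c0; rewrite /c !raddfN /=; lra.
  - by move: x0; rewrite !raddfN /=; case=> ?; [left|right]; lra.
  exists (i + h)%N, r, s; split => //; first by rewrite -addnn ltn_add2r.
  - by rewrite edgeN raddfN /= e1 raddfN mulrN opprK.
  - by rewrite edgeN raddfN /= e2 raddfN mulrN opprK.
move=> c0 y0; have ch : c y h <= 0.
  by move: c0; rewrite /c -[h]add0n wN !raddfN /=; lra.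
have [i [ih ci ci1]] := sign_change h_gt0 c0 ch.
have d0 := w_turn ih; set d := (X in 0 < X) in d0.
(* Cramer's rule in the basis formed by the shadows of [w i] and [w i.+1]. *)
have d1 : d * f1 y = - c y i.+1 * f1 (w i) + c y i * f1 (w i.+1).
  by rewrite /d /c; ring.
have d2 : d * f2 y = - c y i.+1 * f2 (w i) + c y i * f2 (w i.+1).
  by rewrite /d /c; ring.
have cc0 : 0 < c y i - c y i.+1.
  rewrite lt_neqAle; apply/andP; split; last by lra.
  apply/eqP => cc; have ci_eq0 : c y i = 0 by lra.
  have ci1_eq0 : c y i.+1 = 0 by lra.
  move: d1 d2; rewrite ci_eq0 ci1_eq0 oppr0 !mul0r addr0 => d1 d2.
  by case: y0 => y0; [move: d1|move: d2] => /eqP;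
    rewrite mulf_eq0 gt_eqF//= => /eqP.
(* Division by [c y i - c y i.+1] makes the two coefficients sum to 1. *)
exists i, (c y i / (c y i - c y i.+1)), (d / (c y i - c y i.+1)); split => //.
- by rewrite divr_ge0 ?(ltW cc0)//= ler_pdivrMr// mul1r; lra.
- by rewrite divr_gt0.
- rewrite edgeE [RHS]mulrAC d1.
  by field; rewrite gt_eqF.
- rewrite edgeE [RHS]mulrAC d2.
  by field; rewrite gt_eqF.
Qed.

(* The segment projects into a ray from 0, on which the outside of the tunnel
   is a half-line. *)
Lemma spoke_outside x y s t : O x -> O y -> 0 < s ->
  f1 y = s * f1 x -> f2 y = s * f2 x -> 0 <= t <= 1 ->
  O ((1 - t) *: x + t *: y).
Proof.
move=> Ox Oy s0 y1 y2 /andP[t0 t1].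
(* The end whose shadow is nearer to the origin is the one scaled outwards. *)
have [s1|s1] := leP 1 s.
  apply: (outside_starred Ox (s := 1 + t * (s - 1))).
  - by rewrite linearD !linearZ /= y1; ring.
  - by rewrite linearD !linearZ /= y2; ring.
  - by rewrite lerDl mulr_ge0// subr_ge0.
apply: (outside_starred Oy (s := (1 + t * (s - 1)) / s)).
- by rewrite linearD !linearZ /= y1; field; rewrite gt_eqF.
- by rewrite linearD !linearZ /= y2; field; rewrite gt_eqF.
- rewrite ler_pdivlMr// mul1r.
  have : 0 <= (1 - t) * (1 - s) by rewrite mulr_ge0// subr_ge0// ltW.
  lra.
Qed.

Let A := K `\` T.

Lemma interior_outside : A° = K° `&` O.
Proof. by rewrite /A setDE interiorI. Qed.

Lemma loop_in s : s \in `[0, 1] -> A° (polyline w h.*2 s).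
Proof.
have h2 : (0 < h.*2)%N by rewrite double_gt0 h_gt0.
move=> /(itv01_frac h2)[i [r [ih r01 ->]]].
rewrite polylineE// interior_outside.
by split; [exact: edge_in|exact: edge_out].
Qed.

Lemma segment_connected_img (x y : V) :
  connected [set (1 - t) *: x + t *: y | t in `[0, 1]].
Proof.
apply: connected_continuous_connected; first exact: segment_connected.
apply: continuous_subspaceT => t.
apply: cvgD; apply: cvgZr_tmp; last exact: cvg_id.
by apply: cvgB; [exact: cvg_cst|exact: cvg_id].
Qed.

Lemma connected_outside : connected A°.
Proof.
pose g := polyline w h.*2.
have g0 : A° (g 0) by apply: loop_in; rewrite in_itv /= lexx ler01.
suff -> : A° = connected_component A° (g 0) by exact: component_connected.
apply/seteqP; split; last exact: connected_component_sub.
move=> x Ax; have [Kx Ox] : (K° `&` O) x by rewrite -interior_outside.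
have [i [r [s [ih r01 s0 e1 e2]]]] := sector (pi_neq0 Ox).
pose loop := g @` `[0, 1].
pose spoke := [set (1 - t) *: x + t *: edge i r | t in `[0, 1]].
have Eg : edge i r = g ((i%:R + r) / h.*2%:R) by rewrite /g polylineE.
have loopE : loop (edge i r).
  rewrite Eg; exists ((i%:R + r) / h.*2%:R) => //=.
  move/andP: r01 => [r0 r1]; have h2 : 0 < h.*2%:R :> R.
    by rewrite ltr0n (leq_ltn_trans _ ih).
  rewrite in_itv /= divr_ge0 ?addr_ge0 ?ler0n//= ler_pdivrMr// mul1r.
  apply: (@le_trans _ _ i.+1%:R); last by rewrite ler_nat.
  by rewrite -natr1 lerD2l.
apply: (@connected_component_max _ _ (loop `|` spoke)).
- by left; exists 0 => //=; rewrite in_itv /= lexx ler01.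
- move=> _ [[t t01 <-]|[t /= t01 <-]]; first exact: loop_in.
  rewrite interior_outside; split.
    by have /convex_setP := convex_interior cK; apply => //; exact: edge_in.
  by apply: (spoke_outside Ox _ s0) => //; exact: edge_out.
- apply: connectedU.
  + exists (edge i r); split => //; exists 1.
      by rewrite /= in_itv /= ler01 lexx.
    by rewrite subrr scale0r add0r scale1r.
  + apply: connected_continuous_connected; first exact: segment_connected.
    by apply: continuous_subspaceT; exact: polyline_continuous.
  + exact: segment_connected_img.
- right; exists 0; first by rewrite /= in_itv /= lexx ler01.
  by rewrite subr0 scale0r addr0 scale1r.
Qed.

Lemma not_simply_connected : ~ simply_connected R A°.
Proof.
move=> [_ /(_ (w 0%N) (polyline w h.*2)) sc].
have h2 : (0 < h.*2)%N by rewrite double_gt0 h_gt0.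
have /sc : is_path_in A° (w 0%N) (w 0%N) (polyline w h.*2).
  split.
  - by apply: continuous_subspaceT; exact: polyline_continuous.
  - by move=> t; exact: loop_in.
  - have := polylineE w h2 (r := 0); rewrite lexx ler01 addr0 mul0r => -> //.
    by rewrite subr0 scale0r scale1r addr0.
  - have := @polylineE _ _ w h.*2 h.*2.-1 1; rewrite lexx ler01 prednK//.
    rewrite natr1 prednK// divff ?pnatr_eq0 -?lt0n// => -> //.
    rewrite subrr scale0r scale1r add0r.
    by rewrite -addnn wN -[h in w h]add0n wN opprK.
move=> /(@null_homotopic_crossing _ _ _ (fun x => (f1 x, f2 x))) [||N].
- by move=> x; exact: (cvg_pair (@f1_cont x) (@f2_cont x)).
- move=> x; rewrite interior_outside => -[_ /pi_neq0].
  by case=> x0 [x1 x2]; apply: x0.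
(* The number of samples has to be a multiple of [h.*2] and at least [N]. *)
have m0 : (0 < N.+1)%N by [].
have Nn : (N <= h.*2 * N.+1)%N by rewrite (leq_trans (leqnSn N))// leq_pmull.
move=> /(_ _ Nn) crossing0.
by have := crossing_polyline m0 wN f1w0 f1w1 f2w0 f2w; rewrite crossing0.
Qed.

Lemma has_hole_criterion : has_hole A.
Proof. split; [exact: connected_outside|exact: not_simply_connected]. Qed.

End Criterion.

(** * Three-dimensional space *)

Section Space.
Context {R : realType}.
Implicit Types (n u v x y : 'rV[R]_3) (A P : set 'rV[R]_3).

Lemma I3P (i : 'I_3) : [\/ i = 0, i = 1 | i = 2].
Proof.
by case: i => [[|[|[|//]]] ?];
  [constructor 1|constructor 2|constructor 3]; apply: val_inj.
Qed.

Lemma sum_I3 (F : 'I_3 -> R) : \sum_(i < 3) F i = F 0 + F 1 + F 2.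
Proof.
rewrite !big_ord_recl big_ord0 addr0 addrA.
by congr (F _ + F _ + F _); apply: val_inj.
Qed.

Lemma point3_eta x : x = point3 (x 0 0) (x 0 1) (x 0 2).
Proof. by apply/rowP => i; rewrite mxE; case: (I3P i) => ->. Qed.

Lemma point3E (a b c : R) :
  ((point3 a b c 0 0 = a) * (point3 a b c 0 1 = b) *
   (point3 a b c 0 2 = c))%type.
Proof. by rewrite !mxE. Qed.

Lemma point3D (a b c a' b' c' : R) :
  point3 a b c + point3 a' b' c' = point3 (a + a') (b + b') (c + c').
Proof. by apply/rowP => i; rewrite !mxE; case: (I3P i) => ->. Qed.

Lemma point3Z (t a b c : R) :
  t *: point3 a b c = point3 (t * a) (t * b) (t * c).
Proof. by apply/rowP => i; rewrite !mxE; case: (I3P i) => ->. Qed.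

Definition dot n x : R := \sum_(i < 3) n 0 i * x 0 i.

Lemma dotE n x : dot n x = n 0 0 * x 0 0 + n 0 1 * x 0 1 + n 0 2 * x 0 2.
Proof. exact: sum_I3. Qed.

Lemma dot_is_scalar n : scalar (dot n).
Proof. by move=> t x y; rewrite !dotE !mxE; ring. Qed.

HB.instance Definition _ n :=
  GRing.isLinear.Build R 'rV[R]_3 R _ (dot n) (dot_is_scalar n).

Lemma dotZ n t x : dot n (t *: x) = t * dot n x.
Proof. exact: linearZ. Qed.

Lemma dot_continuous n : continuous (dot n).
Proof.
move=> x; have Fx : Filter (nbhs x) := nbhs_filter x.
apply: (cvg_big (F := nbhs x) add_continuous) => i _.
by apply: cvgMl_tmp; exact: coord_continuous.
Qed.

Lemma convex_hull_sub A : A `<=` convex_hull A.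
Proof. exact: sub_smallest. Qed.

Lemma convex_hull_min A P : A `<=` P -> convex_set P -> convex_hull A `<=` P.
Proof. by move=> AP cP; apply: smallest_sub. Qed.

Lemma convex_hull_convex A : convex_set (convex_hull A).
Proof.
apply/convex_setP => x y t Ax Ay t01 P [cP AP].
move/convex_setP : (cP); apply => //; [exact: Ax|exact: Ay].
Qed.

Lemma convex_hullN A : (forall x, A x -> A (- x)) ->
  forall x, convex_hull A x -> convex_hull A (- x).
Proof.
move=> AN; apply: convex_hull_min => [x Ax|].
  by apply: convex_hull_sub; exact: AN.
apply/convex_setP => x y t Ax Ay t01; rewrite /= opprD -!scalerN.
by have /convex_setP := convex_hull_convex (A := A); exact.
Qed.

Lemma convex_hull0 A : A !=set0 -> (forall x, A x -> A (- x)) ->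
  convex_hull A 0.
Proof.
move=> [x Ax] AN; have /convex_setP := convex_hull_convex (A := A).
move=> /(_ x (- x) (1 / 2)).
have -> : (1 - 1 / 2) *: x + (1 / 2) *: - x = 0.
  by rewrite scalerN -scalerBl (_ : 1 - 1 / 2 - 1 / 2 = 0) ?scale0r//; lra.
apply; [exact: convex_hull_sub|apply: convex_hull_sub; exact: AN|].
by apply/andP; split; lra.
Qed.

Lemma convex_hull_dot_le A n c : (forall x, A x -> dot n x <= c) ->
  forall x, convex_hull A x -> dot n x <= c.
Proof.
move=> Ac; apply: (convex_hull_min (P := [set x | dot n x <= c])) => //.
apply/convex_setP => x y t /= xc yc /andP[t0 t1]; rewrite linearD !linearZ /=.
have : 0 <= (1 - t) * (c - dot n x) by rewrite mulr_ge0// subr_ge0.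
have : 0 <= t * (c - dot n y) by rewrite mulr_ge0// subr_ge0.
lra.
Qed.

(* The half-space [dot p x < dot p p] contains every vertex except [p]. *)
Lemma sphere_polyhedron P (N : R) : finite_set P -> ~ coplanar P ->
  (forall p, P p -> dot p p = N) -> polyhedron P.
Proof.
move=> finP ncP PN; split => // p Pp.
have cH : convex_set [set x | dot p x < N].
  apply/convex_setP => x y t /= xc yc /andP[t0 t1]; rewrite linearD !linearZ /=.
  have : 0 <= t * (N - dot p y) by rewrite mulr_ge0// subr_ge0 ltW.
  have [->|t1'] := eqVneq t 1; first lra.
  have : 0 < (1 - t) * (N - dot p x).
    by rewrite mulr_gt0 ?subr_gt0// lt_neqAle t1'.
  lra.
have sub : P `\ p `<=` [set x | dot p x < N].
  move=> q [Pq qp] /=; have := PN _ Pp; have := PN _ Pq; rewrite !dotE => qN pN.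
  (* On the common sphere the squared distance of [p] and [q] is [2 * (N - dot p q)]. *)
  have : 0 < (p 0 0 - q 0 0) ^+ 2 + (p 0 1 - q 0 1) ^+ 2 + (p 0 2 - q 0 2) ^+ 2.
    rewrite lt_neqAle eq_sym !addr_ge0 ?sqr_ge0// andbT.
    rewrite !paddr_eq0 ?addr_ge0 ?sqr_ge0// !sqrf_eq0 !subr_eq0.
    apply/negP => /andP[/andP[/eqP e0 /eqP e1] /eqP e2].
    by apply: qp; rewrite (point3_eta q) (point3_eta p) e0 e1 e2.
  nra.
move=> /(convex_hull_min sub cH) /=; by rewrite PN// ltxx.
Qed.

(** A point near [t *: x] is a combination, with weights [1 - t] and [t], of a point near 0 and of
    [x]. *)
Lemma interior_scale A x (t : R) : convex_set A -> A° 0 -> A x -> 0 <= t < 1 ->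
  A° (t *: x).
Proof.
move=> /convex_setP cA /nbhs_ballP[e /= e0 eA] Ax /andP[t0 t1].
have t1' : 0 < 1 - t by rewrite subr_gt0.
apply/nbhs_ballP; exists ((1 - t) * e); first by rewrite /= mulr_gt0.
move=> y; rewrite -ball_normE /= => xy.
have -> : y = (1 - t) *: ((1 - t)^-1 *: (y - t *: x)) + t *: x.
  by rewrite scalerA divff ?gt_eqF// scale1r subrK.
apply: cA; rewrite ?t0 ?ltW//; apply: eA.
rewrite -ball_normE /= sub0r normrN normrZ gtr0_norm ?invr_gt0//.
by rewrite mulrC ltr_pdivrMr// mulrC distrC.
Qed.

(** Corners give edges, edges give faces and faces the solid box: one coordinate is interpolated at
    a time. *)
Lemma convex_box A (a b c : R) : convex_set A -> 0 < a -> 0 < b -> 0 < c ->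
  (forall e : 'I_3 -> bool,
    A (point3 ((-1) ^+ e 0 * a) ((-1) ^+ e 1 * b) ((-1) ^+ e 2 * c))) ->
  A° 0.
Proof.
move=> /convex_setP cA a0 b0 c0 Acorner.
have interp (F : R -> 'rV[R]_3) (d x : R) : 0 < d -> `|x| < d ->
    (forall t y z : R, F ((1 - t) * y + t * z) = (1 - t) *: F y + t *: F z) ->
    A (F (- d)) -> A (F d) -> A (F x).
  move=> d0; rewrite ltr_norml => /andP[xd1 xd2] FE Fm Fp.
  have -> : x = (1 - (x + d) / (2 * d)) * (- d) + (x + d) / (2 * d) * d.
    by field; rewrite gt_eqF.
  rewrite FE; apply: cA => //; rewrite divr_ge0 ?ler_pdivrMr ?mulr_gt0//=; lra.
pose sgn (s : bool) (d : R) : R := (-1) ^+ s * d.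
have A3 s0 s1 s2 : A (point3 (sgn s0 a) (sgn s1 b) (sgn s2 c)).
  exact: (Acorner (fun i => if i == 0 then s0 else if i == 1 then s1 else s2)).
have sgnN d : (sgn true d = - d) * (sgn false d = d).
  by rewrite /sgn expr1 mulN1r mul1r.
have A2 (x : R) s1 s2 : `|x| < a -> A (point3 x (sgn s1 b) (sgn s2 c)).
  move=> xa; apply: (interp (fun x : R => point3 x _ _) a) => //.
  - by move=> t y z; rewrite !point3Z point3D; congr point3; ring.
  - by have := A3 true s1 s2; rewrite sgnN.
  - by have := A3 false s1 s2; rewrite (sgnN a).
have A1 (x y : R) s2 : `|x| < a -> `|y| < b -> A (point3 x y (sgn s2 c)).
  move=> xa yb; apply: (interp (fun y : R => point3 x y _) b) => //.
  - by move=> t y' z; rewrite !point3Z point3D; congr point3; ring.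
  - by have := A2 x true s2 xa; rewrite (sgnN b).
  - by have := A2 x false s2 xa; rewrite (sgnN b).
have A0 (x y z : R) : `|x| < a -> `|y| < b -> `|z| < c -> A (point3 x y z).
  move=> xa yb zc; apply: (interp (fun z : R => point3 x y z) c) => //.
  - by move=> t y' z'; rewrite !point3Z point3D; congr point3; ring.
  - by have := A1 x y true xa yb; rewrite (sgnN c).
  - by have := A1 x y false xa yb; rewrite (sgnN c).
apply/nbhs_ballP; exists (Num.min a (Num.min b c)).
  by rewrite /= !lt_min a0 b0.
move=> x [_ xb]; rewrite (point3_eta x).
have bnd i : `|x 0 i| < Num.min a (Num.min b c).
  by have := xb 0 i; rewrite mxE -ball_normE /= sub0r normrN.
by apply: A0; [have := bnd 0|have := bnd 1|have := bnd 2];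
  rewrite !lt_min => /and3P[].
Qed.

End Space.

(** * The truncated icosidodecahedron *)

Section Tid.
Context {R : realType}.
Implicit Types (x p : 'rV[R]_3).
Local Notation Phi := (golden_ratio R).
Local Notation tid := (truncated_icosidodecahedron R).

Lemma Phi_sqr : Phi * Phi = Phi + 1.
Proof.
have : Num.sqrt 5 * Num.sqrt 5 = 5 :> R by rewrite -expr2 sqr_sqrtr.
rewrite /golden_ratio => s5; set s := Num.sqrt 5 in s5 *.
have -> : (1 + s) / 2 * ((1 + s) / 2) = (1 + 2 * s + s * s) / 4 by field.
by rewrite s5; field.
Qed.

(** Quotients of consecutive Fibonacci numbers; a bracket of width about 1e-5 is fine enough for the
    numerical comparisons below. *)
Lemma Phi_bounds : 377 / 233 < Phi < 610 / 377.
Proof.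
have Phi1 : 1 <= Phi.
  have : 1 <= Num.sqrt 5 :> R by rewrite -[X in X <= _]sqrtr1 ler_sqrt; lra.
  rewrite /golden_ratio; lra.
have P2 := Phi_sqr; apply/andP; split; nra.
Qed.

Lemma invPhi : 1 / Phi = Phi - 1.
Proof.
have := Phi_sqr; have /andP[lo _] := Phi_bounds => P2.
have P0 : Phi != 0 by rewrite gt_eqF//; lra.
by apply: (mulIf P0); rewrite divfK//; lra.
Qed.

Lemma tid_baseE : tid_base R =
  [:: point3 (Phi - 1) (Phi - 1) (3 + Phi);
      point3 (2 * Phi - 2) Phi (1 + 2 * Phi);
      point3 (Phi - 1) (Phi + 1) (-1 + 3 * Phi);
      point3 (2 * Phi - 1) 2 (2 + Phi);
      point3 Phi 3 (2 * Phi)].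
Proof.
rewrite /tid_base; have -> : 2 / Phi = 2 * Phi - 2.
  by rewrite -(mulr1 2) -mulrA invPhi; ring.
have -> : Phi ^+ 2 = Phi + 1 by rewrite expr2 Phi_sqr.
by rewrite invPhi.
Qed.

(** Addition in ['I_3] is modulo 3, so a translation has trivial cube and therefore even sign. *)
Lemma translation_even (k : 'I_3) : ~~ odd_perm (perm (addIr k)).
Proof.
set s := perm _; have s3 : (s ^+ 3 = 1)%g.
  apply/permP => j; rewrite !expgS expg0 mulg1 !permM !permE -!addrA.
  by case: (I3P j) => ->; case: (I3P k) => ->; apply: val_inj.
have := congr1 (@odd_perm _) s3.
by rewrite !expgS expg0 mulg1 !odd_permM odd_perm1; case: (odd_perm s).
Qed.

(** Followed by a suitable translation, [s] fixes 0; being even, it cannot then swap 1 and 2. *)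
Lemma even_perm_translation (s : 'S_3) :
  ~~ odd_perm s -> forall j, s j = j + s 0.
Proof.
move=> s_even j; pose t := (s * perm (addIr (- s 0%R)))%g.
have t_even : ~~ odd_perm t.
  by rewrite odd_permM (negbTE s_even) (negbTE (translation_even _)).
have t0 : t 0 = 0 by rewrite permM permE subrr.
suff tj : t j = j by move: tj; rewrite permM permE => /(canRL (subrK _)).
have t_neq i l : i != l -> t i != t l by rewrite (inj_eq perm_inj).
have [t1|t1|t1] := I3P (t 1).
- by have := t_neq 0 1 isT; rewrite t0 t1.
- have [t2|t2|t2] := I3P (t 2).
  + by have := t_neq 0 2 isT; rewrite t0 t2.
  + by have := t_neq 1 2 isT; rewrite t1 t2.
  + by case: (I3P j) => ->.
- have t2 : t 2 = 1.
    have [t2|//|t2] := I3P (t 2).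
      by have := t_neq 0 2 isT; rewrite t0 t2.
    by have := t_neq 1 2 isT; rewrite t1 t2.
  have tE : t = tperm 1 2.
    apply/permP => i; case: (I3P i) => ->.
    - by rewrite t0 tpermD.
    - by rewrite t1 tpermL.
    - by rewrite t2 tpermR.
  by move: t_even; rewrite tE odd_tperm.
Qed.

(** Even permutations of three indices are the cyclic shifts, which leaves three cases. *)
Lemma tidP x : tid x <-> exists (k : 'I_3) (e : 'I_3 -> bool) p,
  p \in tid_base R /\ forall j, x 0 j = (-1) ^+ e j * p 0 (j + k).
Proof.
split=> [[s [e [p [s_even pB ->]]]]|[k [e [p [pB xE]]]]].
  exists (s 0), (fun j => e (s j)), p; split => // j.
  by rewrite !mxE -(even_perm_translation s_even).
exists (perm (addIr k)), (fun j => e (j - k)), p.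
split; rewrite ?translation_even//; apply/rowP => j.
by rewrite !mxE permE xE addrK.
Qed.

Lemma tidN x : tid x -> tid (- x).
Proof.
move=> /tidP[k [e [p [pB xE]]]]; apply/tidP.
exists k, (fun j => ~~ e j), p; split => // j.
by rewrite mxE xE -mulNr; case: (e j); rewrite ?opprK.
Qed.

Lemma tid_norm x : tid x -> dot x x = 14 + 5 * Phi.
Proof.
move=> /tidP[k [e [p [pB xE]]]].
have -> : dot x x = dot p p.
  rewrite /dot [RHS](reindex_inj (addIr k)) /=; apply: eq_bigr => j _.
  by rewrite xE mulrACA -expr2 sqrr_sign mul1r.
have P2 := Phi_sqr; rewrite dotE.
by move: pB; rewrite tid_baseE !inE => /or4P[|||/orP[]] /eqP ->;
  rewrite !point3E; ring: P2.
Qed.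

Lemma tid_finite : finite_set tid.
Proof.
pose F (i : 'I_3 * {ffun 'I_3 -> bool} * 'I_5) : 'rV[R]_3 :=
  \row_j ((-1) ^+ i.1.2 j * (tid_base R)`_i.2 0 (j + i.1.1)).
apply: (@sub_finite_set _ _ (F @` setT)).
  move=> x /tidP[k [e [p [pB xE]]]].
  have pi : (index p (tid_base R) < 5)%N by rewrite index_mem.
  exists (k, [ffun j => e j], Ordinal pi) => //; apply/rowP => j.
  by rewrite !mxE /= ffunE nth_index// xE.
by apply: finite_image; exact: finite_finset.
Qed.

End Tid.

(** * The rotated copy *)

Section Passage.
Context {R : realType}.
Implicit Types (n p u x y : 'rV[R]_3).
Local Notation Phi := (golden_ratio R).
Local Notation tid := (truncated_icosidodecahedron R).

(* The rotation of the unit quaternion (9 + 8i + 9j - 11k) / sqrt 347, found,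
   like [axis], by a numerical search: the shadow of the rotated polyhedron
   along [axis] fits into that of the original one with a relative slack of
   about 5e-4. *)
Definition rot x : 'rV[R]_3 :=
  point3 ((-57 * x 0 0 + 342 * x 0 1 - 14 * x 0 2) / 347)
         ((-54 * x 0 0 - 23 * x 0 1 - 342 * x 0 2) / 347)
         ((-338 * x 0 0 - 54 * x 0 1 + 57 * x 0 2) / 347).

(** The transpose of [rot]: it turns functionals on the copy into functionals on the original
    vertices. *)
Definition rot_dual n : 'rV[R]_3 :=
  point3 ((-57 * n 0 0 - 54 * n 0 1 - 338 * n 0 2) / 347)
         ((342 * n 0 0 - 23 * n 0 1 - 54 * n 0 2) / 347)
         ((-14 * n 0 0 - 342 * n 0 1 + 57 * n 0 2) / 347).

Definition axis : 'rV[R]_3 := point3 9 12 13.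

Lemma dot_rot n x : dot n (rot x) = dot (rot_dual n) x.
Proof. by rewrite !dotE !point3E; ring. Qed.

Lemma rot_dot x : dot (rot x) (rot x) = dot x x.
Proof. by rewrite !dotE !point3E; field. Qed.

Lemma rotB x y : rot x - rot y = rot (x - y).
Proof.
by apply/rowP => i; rewrite !mxE; case: (I3P i) => -> /=; ring.
Qed.

Lemma rotN x : rot (- x) = - rot x.
Proof. by apply/rowP => i; rewrite !mxE; case: (I3P i) => -> /=; ring. Qed.

Lemma rot_dual_inj0 n : rot_dual n = 0 -> n = 0.
Proof.
move=> /rowP n0; have := (n0 0, n0 1, n0 2).
rewrite !point3E !mxE => -[[e0 e1] e2].
by rewrite (point3_eta n); apply/rowP => i; rewrite !mxE;
  case: (I3P i) => -> /=; lra.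
Qed.

Lemma congruent_rot : congruent tid (rot @` tid).
Proof.
exists rot; split => // x y; rewrite rotB /euclidean_norm; congr Num.sqrt.
have := rot_dot (x - y); rewrite /dot => rE.
transitivity (\sum_(i < 3) rot (x - y) 0 i * rot (x - y) 0 i).
  by apply: eq_bigr => i _; rewrite expr2.
by rewrite rE; apply: eq_bigr => i _; rewrite expr2.
Qed.

(** The vertex set is closed under sign changes, so membership reduces to polynomial identities
    between squares. *)
Lemma tid_mem p x : p \in tid_base R ->
  [\/ [/\ x 0 0 ^+ 2 = p 0 0 ^+ 2, x 0 1 ^+ 2 = p 0 1 ^+ 2 &
          x 0 2 ^+ 2 = p 0 2 ^+ 2],
      [/\ x 0 0 ^+ 2 = p 0 1 ^+ 2, x 0 1 ^+ 2 = p 0 2 ^+ 2 &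
          x 0 2 ^+ 2 = p 0 0 ^+ 2] |
      [/\ x 0 0 ^+ 2 = p 0 2 ^+ 2, x 0 1 ^+ 2 = p 0 0 ^+ 2 &
          x 0 2 ^+ 2 = p 0 1 ^+ 2]] -> tid x.
Proof.
move=> pB xp; have [k xk] : exists k : 'I_3,
    forall j, x 0 j ^+ 2 = p 0 (j + k) ^+ 2.
  by case: xp => -[x0 x1 x2]; [exists 0|exists 1|exists 2];
    move=> j; case: (I3P j) => ->; rewrite ?x0 ?x1 ?x2; congr (p 0 _ ^+ 2);
    apply: val_inj.
apply/tidP; exists k, (fun j => x 0 j != p 0 (j + k)), p; split=> // j.
have /eqP := xk j; rewrite eqf_sqr => /orP[/eqP->|/eqP ->].
  by rewrite eqxx mul1r.
by case: eqP => [e|_]; rewrite ?e ?mul1r ?mulN1r.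
Qed.

Lemma tid_corner (e : 'I_3 -> bool) :
  tid (point3 ((-1) ^+ e 0 * Phi) ((-1) ^+ e 1 * 3) ((-1) ^+ e 2 * (2 * Phi))).
Proof.
apply: (tid_mem (p := point3 Phi 3 (2 * Phi))).
  by rewrite tid_baseE !inE eqxx !orbT.
by constructor 1; rewrite !point3E !exprMn !sqrr_sign !mul1r.
Qed.

(** Flipping one sign at a corner of the box keeps the functional constant, so each coordinate of
    its normal vanishes. *)
Lemma not_coplanar_rot : ~ coplanar (rot @` tid).
Proof.
move=> [n [c [n0 nc]]]; move/eqP: n0; apply; apply: rot_dual_inj0.
have mc x : tid x -> dot (rot_dual n) x = c.
  by move=> tx; rewrite -dot_rot; apply: nc; exists x.
have P0 := Phi_bounds (R := R).
have corner (s0 s1 s2 : bool) : (-1) ^+ s0 * Phi * rot_dual n 0 0 +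
    (-1) ^+ s1 * 3 * rot_dual n 0 1 +
    (-1) ^+ s2 * (2 * Phi) * rot_dual n 0 2 = c.
  have := mc _ (tid_corner
    (fun i => if i == 0 then s0 else if i == 1 then s1 else s2)).
  by rewrite dotE !point3E /= => <-; ring.
have c0 := corner false false false; have c1 := corner true false false.
have c2 := corner false true false; have c3 := corner false false true.
rewrite !expr1 !expr0 in c0 c1 c2 c3.
have Phi0 : Phi != 0 by rewrite gt_eqF//; lra.
have m0 : Phi * rot_dual n 0 0 = 0 by lra.
have m1 : rot_dual n 0 1 = 0 by lra.
have m2 : Phi * rot_dual n 0 2 = 0 by lra.
apply/rowP => i; rewrite [RHS]mxE; case: (I3P i) => -> //.
  by move/eqP: m0; rewrite mulf_eq0 (negbTE Phi0) => /eqP.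
by move/eqP: m2; rewrite mulf_eq0 (negbTE Phi0) => /eqP.
Qed.

Lemma polyhedron_rot : polyhedron (rot @` tid).
Proof.
apply: (@sphere_polyhedron _ _ (14 + 5 * Phi)).
- exact/finite_image/tid_finite.
- exact: not_coplanar_rot.
- by move=> _ [x tx <-]; rewrite rot_dot tid_norm.
Qed.

(** Base points have nonnegative coordinates, so absolute values cover all sign choices at once;
    three shifts of five points remain. *)
Lemma rot_hull_le n (c : R) : let m i := `|rot_dual n 0 i| in
  {in tid_base R, forall p,
    [/\ m 0 * p 0 0 + m 1 * p 0 1 + m 2 * p 0 2 <= c,
        m 0 * p 0 1 + m 1 * p 0 2 + m 2 * p 0 0 <= c &
        m 0 * p 0 2 + m 1 * p 0 0 + m 2 * p 0 1 <= c]} ->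
  forall q, convex_hull (rot @` tid) q -> dot n q <= c.
Proof.
move=> m mc; apply: convex_hull_dot_le => _ [x /tidP[k [e [p [pB xE]]]] <-].
have p_ge0 : [/\ 0 <= p 0 0, 0 <= p 0 1 & 0 <= p 0 2].
  have /andP[lo hi] := Phi_bounds (R := R).
  by move: pB; rewrite tid_baseE !inE => /or4P[|||/orP[]] /eqP ->;
    rewrite !point3E; split; lra.
have p_ge0' j : 0 <= p 0 j by case: p_ge0; case: (I3P j) => ->.
rewrite dot_rot; apply: (@le_trans _ _ (\sum_(j < 3) m j * p 0 (j + k))).
  apply: ler_sum => j _; rewrite xE mulrA; apply: le_trans (ler_norm _) _.
  by rewrite !normrM normr_sign mulr1 (ger0_norm (p_ge0' _)).
rewrite sum_I3; have [c0 c1 c2] := mc p pB.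
have i3 : (1 + 1 = 2 :> 'I_3) * (1 + 2 = 0 :> 'I_3) * (2 + 1 = 0 :> 'I_3) *
    (2 + 2 = 1 :> 'I_3).
  by do !split; apply: val_inj.
by case: (I3P k) => ->; rewrite ?addr0 ?add0r ?i3.
Qed.

Lemma separating_functional n (c : R) x y : dot n axis = 0 ->
  {in tid_base R, forall p, let m i := `|rot_dual n 0 i| in
    [/\ m 0 * p 0 0 + m 1 * p 0 1 + m 2 * p 0 2 <= c,
        m 0 * p 0 1 + m 1 * p 0 2 + m 2 * p 0 0 <= c &
        m 0 * p 0 2 + m 1 * p 0 0 + m 2 * p 0 1 <= c]} ->
  c < dot n x -> c < dot n y ->
  exists (g : {scalar 'rV[R]_3}) (b : R),
    [/\ continuous g, g axis = 0,
        forall q, convex_hull (rot @` tid) q -> g q <= b, b < g x & b < g y].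
Proof.
move=> na mc cx cy; exists (dot n), c; split => //; first exact: dot_continuous.
exact: rot_hull_le.
Qed.

End Passage.

(** * Exact arithmetic in Z[Phi] *)

Section ExactArithmetic.
Context {R : realType}.
Local Notation Phi := (golden_ratio R).
Local Notation Z := BinNums.Z.

(* Binary integers let the 225 vertex inequalities be decided by computation. *)
Definition ofZ : Z -> R := intr \o int_of_Z.

HB.instance Definition _ := GRing.RMorphism.copy ofZ (intr \o int_of_Z).

Lemma ofZ_simp :
  (forall n, ofZ n%:R = n%:R) * (forall x, ofZ (- x) = - ofZ x) *
  (forall x y, ofZ (x * y) = ofZ x * ofZ y) *
  (forall x y, ofZ (x + y) = ofZ x + ofZ y).
Proof.
by split=> [|x y]; [split=> [|x y]; [split=> [n|x]|]|];
  rewrite (rmorphD, rmorphN, rmorphM, rmorph_nat).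
Qed.

Lemma ofZ_ge0 (z : Z) : 0 <= z -> 0 <= ofZ z.
Proof. by case: z => // p _; rewrite /ofZ /= ler0z. Qed.

Lemma ofZ_gt0 (z : Z) : 0 < z -> 0 < ofZ z.
Proof. by case: z => // p _; rewrite /ofZ /= ltr0z /=; lia. Qed.

Lemma ofZ_norm (z : Z) : ofZ `|z| = `|ofZ z|.
Proof.
case: (ger0P z) => z0; first by rewrite ger0_norm// ofZ_ge0.
by rewrite ler0_norm ?rmorphN// -oppr_ge0 -rmorphN ofZ_ge0// oppr_ge0 ltW.
Qed.

Definition ofZPhi (z : Z * Z) : R := ofZ z.1 + ofZ z.2 * Phi.

(* Sound because 377 / 233 and 610 / 377 bracket [Phi]. *)
Definition nonnegZPhi (z : Z * Z) : bool :=
  (0 <= 233 * z.1 + 377 * z.2) && (0 <= 377 * z.1 + 610 * z.2).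

Lemma ofZPhi_ge0 z : nonnegZPhi z -> 0 <= ofZPhi z.
Proof.
move=> /andP[/ofZ_ge0 + /ofZ_ge0]; rewrite !ofZ_simp /ofZPhi.
have /andP[lo hi] := Phi_bounds (R := R); have [z0|z0] := leP 0 (ofZ z.2); nra.
Qed.

Definition tid_baseZ : seq ((Z * Z) * (Z * Z) * (Z * Z)) :=
  [:: ((-1, 1), (-1, 1), (3, 1));
      ((-2, 2), (0, 1), (1, 2));
      ((-1, 1), (1, 1), (-1, 3));
      ((-1, 2), (2, 0), (2, 1));
      ((0, 1), (3, 0), (0, 2))].

Lemma tid_base_ofZ : tid_base R =
  [seq point3 (ofZPhi t.1.1) (ofZPhi t.1.2) (ofZPhi t.2) | t <- tid_baseZ].
Proof.
rewrite tid_baseE /= /ofZPhi /= !(rmorphN, rmorph1, rmorph0, rmorph_nat).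
by congr [:: point3 _ _ _; point3 _ _ _; point3 _ _ _; point3 _ _ _;
  point3 _ _ _]; ring.
Qed.

(* 347 times [rot_dual]. *)
Definition rot_dualZ (n0 n1 n2 : Z) : Z * Z * Z :=
  (-57 * n0 - 54 * n1 - 338 * n2, 342 * n0 - 23 * n1 - 54 * n2,
   -14 * n0 - 342 * n1 + 57 * n2).

(** The pair given to [nonnegZPhi] is [347 * d] times the slack of the bound [k / d] at a vertex;
    the three tests are the cyclic shifts. *)
Definition support_le (n0 n1 n2 k d : Z) : bool :=
  let m := rot_dualZ n0 n1 n2 in
  let ok (x y z : Z * Z) := nonnegZPhi
    (347 * k - d * (`|m.1.1| * x.1 + `|m.1.2| * y.1 + `|m.2| * z.1),
     - d * (`|m.1.1| * x.2 + `|m.1.2| * y.2 + `|m.2| * z.2)) in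
  all (fun t => let: (x, y, z) := t in [&& ok x y z, ok y z x & ok z x y])
    tid_baseZ.

Lemma weighted_le (a0 a1 a2 k d : Z) (u v w : Z * Z) : 0 < ofZ d ->
  nonnegZPhi (347 * k - d * (a0 * u.1 + a1 * v.1 + a2 * w.1),
    - d * (a0 * u.2 + a1 * v.2 + a2 * w.2)) ->
  ofZ a0 / 347 * ofZPhi u + ofZ a1 / 347 * ofZPhi v + ofZ a2 / 347 * ofZPhi w
    <= ofZ k / ofZ d.
Proof.
move=> d0 /ofZPhi_ge0; rewrite [ofZPhi]lock /= -lock /ofZPhi !ofZ_simp => h.
rewrite ler_pdivlMr// -subr_ge0 -(pmulr_rge0 _ (ltr0Sn R 346)).
by move: h; congr (0 <= _); field.
Qed.

Lemma support_leP (n0 n1 n2 k d : Z) : 0 < ofZ d -> support_le n0 n1 n2 k d ->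
  forall p, p \in tid_base R ->
    let m i := `|rot_dual (point3 (ofZ n0) (ofZ n1) (ofZ n2)) 0 i| in
    let c := ofZ k / ofZ d in
    [/\ m 0 * p 0 0 + m 1 * p 0 1 + m 2 * p 0 2 <= c,
        m 0 * p 0 1 + m 1 * p 0 2 + m 2 * p 0 0 <= c &
        m 0 * p 0 2 + m 1 * p 0 0 + m 2 * p 0 1 <= c].
Proof.
move=> d0 /allP ok p; rewrite tid_base_ofZ => /mapP[[[x y] z] /ok + ->] m c.
set mZ := rot_dualZ n0 n1 n2 => /and3P[].
have mE : (m 0 = ofZ `|mZ.1.1| / 347) * (m 1 = ofZ `|mZ.1.2| / 347) *
    (m 2 = ofZ `|mZ.2| / 347).
  have i347 : (347 : R)^-1 = `|347^-1| by rewrite ger0_norm ?invr_ge0 ?ler0n.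
  by split; [split|]; rewrite ofZ_norm i347 -normrM /m /rot_dual point3E /mZ
    /rot_dualZ [X in ofZ X]/= !point3E !ofZ_simp; congr (`|_|); field.
rewrite !mE !point3E => + + +.
by move=> *; split; apply: weighted_le.
Qed.

(** The conditions on the tunnel become a boolean over binary integers, to be computed; only the two
    inequalities at the loop stay in [R]. *)
Lemma separating_functionalZ (n0 n1 n2 k d : Z) (x y : 'rV[R]_3) :
  let n := point3 (ofZ n0) (ofZ n1) (ofZ n2) : 'rV[R]_3 in
  [&& 0 < d, 9 * n0 + 12 * n1 + 13 * n2 == 0 & support_le n0 n1 n2 k d] ->
  ofZ k / ofZ d < dot n x -> ofZ k / ofZ d < dot n y ->
  exists (g : {scalar 'rV[R]_3}) (b : R),
    [/\ continuous g, g axis = 0,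
        forall q, convex_hull (rot @` truncated_icosidodecahedron R) q ->
          g q <= b, b < g x & b < g y].
Proof.
move=> n /and3P[d0 /eqP n_axis ok] cx cy.
apply: (separating_functional (n := n) (c := ofZ k / ofZ d)) => //.
- have := congr1 (fun z => ofZ z) n_axis.
  rewrite (ofZ_simp.1.1.1 0%N) !ofZ_simp.
  by rewrite dotE !point3E => e; rewrite -[RHS]e; ring.
- by apply: support_leP => //; exact: ofZ_gt0.
Qed.

End ExactArithmetic.

(** * The silhouette *)

Section Silhouette.
Context {R : realType}.
Implicit Types (n p u x y : 'rV[R]_3).
Local Notation Phi := (golden_ratio R).
Local Notation tid := (truncated_icosidodecahedron R).

(* Half of the 30 vertices of the shadow of the polyhedron along [axis], in
   cyclic order; the last entry is the antipode of the first. *)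
Definition silhouette : seq 'rV[R]_3 :=
  [:: point3 (2 + Phi) (1 - 2 * Phi) (-2);
      point3 (1 + 2 * Phi) (2 - 2 * Phi) (- Phi);
      point3 (-1 + 3 * Phi) (1 - Phi) (-1 - Phi);
      point3 (-1 + 3 * Phi) (-1 + Phi) (-1 - Phi);
      point3 (2 * Phi) Phi (-3);
      point3 (-1 + 2 * Phi) 2 (-2 - Phi);
      point3 Phi 3 (-2 * Phi);
      point3 (-1 + Phi) (1 + Phi) (1 - 3 * Phi);
      point3 (1 - Phi) (1 + Phi) (1 - 3 * Phi);
      point3 (- Phi) 3 (-2 * Phi);
      point3 (-2) (2 + Phi) (1 - 2 * Phi);
      point3 (-3) (2 * Phi) (- Phi);
      point3 (-1 - Phi) (-1 + 3 * Phi) (1 - Phi);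
      point3 (-1 - Phi) (-1 + 3 * Phi) (-1 + Phi);
      point3 (-3) (2 * Phi) Phi;
      point3 (-2 - Phi) (-1 + 2 * Phi) 2].

(* Moves the loop into the interior; small compared with the slack. *)
Definition shrink : R := 1 - 1 / 70 ^+ 2.

(** Each block of 15 indices switches the sign, so the vertices run around the shadow with period
    30. *)
Definition loop_vertex (i : nat) : 'rV[R]_3 :=
  shrink *: ((-1) ^+ (i %/ 15) *: silhouette`_(i %% 15)).

Lemma loop_vertexN i : loop_vertex (i + 15) = - loop_vertex i.
Proof.
rewrite /loop_vertex divnDr// divnn addn1 modnDr exprS mulN1r scaleNr.
by rewrite scalerN.
Qed.

(** At [i = 15] the wrapped index gives the antipode of entry 0, which is the last entry of
    [silhouette]. *)
Lemma loop_vertexE i : (i <= 15)%N -> loop_vertex i = shrink *: silhouette`_i.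
Proof.
rewrite leq_eqVlt => /orP[/eqP->|i15]; last first.
  by rewrite /loop_vertex divn_small// modn_small// scale1r.
rewrite /loop_vertex divnn modnn expr1; congr (_ *: _).
by apply/rowP => j; rewrite !mxE; case: (I3P j) => -> /=; ring.
Qed.

Ltac squares := rewrite tid_baseE /= !point3E; split; ring.

Lemma silhouette_tid i : (i < 15)%N -> tid silhouette`_i.
Proof.
have base (j : nat) (j5 : (j < 5)%N) : (tid_base R)`_j \in tid_base R.
  exact: mem_nth.
case: i => [|[|[|[|[|[|[|[|[|[|[|[|[|[|[|//]]]]]]]]]]]]]]] _.
- by apply: (tid_mem (base 3%N isT)); constructor 3; squares.
- by apply: (tid_mem (base 1%N isT)); constructor 3; squares.
- by apply: (tid_mem (base 2%N isT)); constructor 3; squares.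
- by apply: (tid_mem (base 2%N isT)); constructor 3; squares.
- by apply: (tid_mem (base 4%N isT)); constructor 3; squares.
- by apply: (tid_mem (base 3%N isT)); constructor 1; squares.
- by apply: (tid_mem (base 4%N isT)); constructor 1; squares.
- by apply: (tid_mem (base 2%N isT)); constructor 1; squares.
- by apply: (tid_mem (base 2%N isT)); constructor 1; squares.
- by apply: (tid_mem (base 4%N isT)); constructor 1; squares.
- by apply: (tid_mem (base 3%N isT)); constructor 2; squares.
- by apply: (tid_mem (base 4%N isT)); constructor 2; squares.
- by apply: (tid_mem (base 2%N isT)); constructor 2; squares.
- by apply: (tid_mem (base 2%N isT)); constructor 2; squares.
- by apply: (tid_mem (base 4%N isT)); constructor 2; squares.
Qed.

Lemma convex_hull_tid_interior0 : (convex_hull tid)° 0.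
Proof.
have /andP[lo hi] := Phi_bounds (R := R).
apply: (convex_box (a := Phi) (b := 3) (c := 2 * Phi)); try lra.
  exact: convex_hull_convex.
by move=> e; apply: convex_hull_sub; exact: tid_corner.
Qed.

Lemma loop_vertex_interior i : (convex_hull tid)° (loop_vertex i).
Proof.
apply: interior_scale; last by rewrite /shrink; apply/andP; split; lra.
- exact: convex_hull_convex.
- exact: convex_hull_tid_interior0.
have /silhouette_tid t : (i %% 15 < 15)%N by rewrite ltn_mod.
apply: convex_hull_sub.
by rewrite -signr_odd; case: odd; rewrite ?scaleN1r ?scale1r//; exact: tidN.
Qed.

(** Up to the factor 13, [proj1] and [proj2] are the coordinates of the point where the line along
    [axis] meets the plane of the first two coordinates. *)
Definition proj1 : 'rV[R]_3 := point3 13 0 (-9).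
Definition proj2 : 'rV[R]_3 := point3 0 13 (-12).

Ltac margin := rewrite dotZ dotE !point3E !ofZ_simp /shrink; lra.

(** Each case names a line of the shadow by an integer normal orthogonal to [axis] and a bound
    [k / d]. It only has to pass between the copy and the shrunk edge, so one normal may serve
    several edges. *)
Lemma loop_vertex_separated i : (i < 15)%N ->
  exists (g : {scalar 'rV[R]_3}) (b : R),
    [/\ continuous g, g axis = 0,
        forall q, convex_hull (rot @` tid) q -> g q <= b,
        b < g (loop_vertex i) & b < g (loop_vertex i.+1)].
Proof.
move=> i15; rewrite !loop_vertexE//; last exact: ltnW.
have /andP[lo hi] := Phi_bounds (R := R).
have sep (n0 n1 n2 k d : BinNums.Z) := separating_functionalZ (R := R)
  (n0 := n0) (n1 := n1) (n2 := n2) (k := k) (d := d).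
case: i i15 => [|[|[|[|[|[|[|[|[|[|[|[|[|[|[|//]]]]]]]]]]]]]]] _.
- apply: (sep 91 (-52) (-15) 1421 3); [by vm_compute| |]; margin.
- apply: (sep 65 (-13) (-33) 342 1); [by vm_compute| |]; margin.
- apply: (sep 13 0 (-9) 147 2); [by vm_compute| |]; margin.
- apply: (sep 52 13 (-48) 333 1); [by vm_compute| |]; margin.
- apply: (sep 39 26 (-51) 641 2); [by vm_compute| |]; margin.
- apply: (sep 13 13 (-21) 639 5); [by vm_compute| |]; margin.
- apply: (sep 0 13 (-12) 155 2); [by vm_compute| |]; margin.
- apply: (sep 0 13 (-12) 78 1); [by vm_compute| |]; margin.
- apply: (sep 0 13 (-12) 155 2); [by vm_compute| |]; margin.
- apply: (sep (-1) 4 (-3) 185 8); [by vm_compute| |]; margin.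
- apply: (sep (-26) 39 (-18) 233 1); [by vm_compute| |]; margin.
- apply: (sep (-13) 13 (-3) 859 10); [by vm_compute| |]; margin.
- apply: (sep (-4) 3 0 131 6); [by vm_compute| |]; margin.
- apply: (sep (-39) 26 3 203 1); [by vm_compute| |]; margin.
- apply: (sep (-39) 26 3 204 1); [by vm_compute| |]; margin.
Qed.

Lemma silhouette_turn i : (i < 15)%N ->
  0 < dot proj1 silhouette`_i * dot proj2 silhouette`_i.+1
    - dot proj2 silhouette`_i * dot proj1 silhouette`_i.+1.
Proof.
(* [P2] turns the quadratic cross products into affine expressions in [Phi]. *)
have /andP[lo hi] := Phi_bounds (R := R); have P2 := Phi_sqr (R := R).
by case: i => [|[|[|[|[|[|[|[|[|[|[|[|[|[|[|//]]]]]]]]]]]]]]] _;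
  rewrite /= !dotE !point3E; lra.
Qed.

Lemma shrink_gt0 : 0 < shrink.
Proof. by rewrite /shrink; lra. Qed.

Lemma loop_vertex_turn i : (i < 15)%N ->
  0 < dot proj1 (loop_vertex i) * dot proj2 (loop_vertex i.+1)
    - dot proj2 (loop_vertex i) * dot proj1 (loop_vertex i.+1).
Proof.
move=> i15; rewrite !loop_vertexE ?(ltnW i15)// !dotZ.
have scaleE (s a b c d : R) : s * a * (s * d) - s * b * (s * c) =
  s * s * (a * d - b * c) by ring.
by rewrite scaleE !mulr_gt0 ?shrink_gt0// silhouette_turn.
Qed.

Lemma loop_vertex_upper i : (0 < i < 15)%N -> 0 < dot proj2 (loop_vertex i).
Proof.
move=> /andP[i0 i15]; rewrite loop_vertexE ?(ltnW i15)// dotZ.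
rewrite mulr_gt0 ?shrink_gt0//; have /andP[lo hi] := Phi_bounds (R := R).
by case: i i0 i15 => [//|[|[|[|[|[|[|[|[|[|[|[|[|[|[|//]]]]]]]]]]]]]]] _ _;
  rewrite /= dotE !point3E; lra.
Qed.

Lemma loop_vertex_start :
  [/\ 0 < dot proj1 (loop_vertex 0), 0 < dot proj1 (loop_vertex 1) &
      dot proj2 (loop_vertex 0) < 0].
Proof.
have /andP[lo hi] := Phi_bounds (R := R).
rewrite !loop_vertexE// !dotZ !pmulr_rgt0 ?pmulr_rlt0 ?shrink_gt0//.
by split; rewrite dotE !point3E; lra.
Qed.

Lemma proj_axis : dot proj1 axis = 0 /\ dot proj2 axis = 0.
Proof. by split; rewrite dotE !point3E; lra. Qed.

Lemma proj_kernel (x : 'rV[R]_3) : dot proj1 x = 0 -> dot proj2 x = 0 ->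
  exists t, x = t *: axis.
Proof.
rewrite !dotE !point3E => x1 x2; exists (x 0 2 / 13).
by rewrite point3Z {1}(point3_eta x); congr point3; lra.
Qed.

End Silhouette.

Theorem theorem2 (R : realType) : Rupert (truncated_icosidodecahedron R).
Proof.
have tid0 : rot @` truncated_icosidodecahedron R !=set0.
  by apply: image_nonempty; eexists; exact: (tid_corner (fun=> false)).
have rot_tidN x : (rot @` truncated_icosidodecahedron R) x ->
    (rot @` truncated_icosidodecahedron R) (- x).
  by move=> [y ty <-]; exists (- y); [exact: tidN|exact: rotN].
have /andP[lo hi] := Phi_bounds (R := R).
exists (rot @` truncated_icosidodecahedron R), axis; split.
- exact: polyhedron_rot.
- exact: congruent_rot.
- apply/eqP => /rowP/(_ 0); rewrite !mxE /=; lra.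
(* Here [K] is the hull of the original, [C] that of the copy, and 15 is half the number of
   silhouette vertices. *)
apply: (@has_hole_criterion R _ _ axis (dot proj1) (dot proj2)
  _ _ _ _ _ _ _ _ _ 15 loop_vertex).
- exact: convex_hull_convex.
- exact: convex_hull_convex.
- exact: convex_hull0.
- exact: convex_hullN.
- exact: dot_continuous.
- exact: dot_continuous.
- by case: (@proj_axis R).
- by case: (@proj_axis R).
- exact: proj_kernel.
- exact: loop_vertexN.
- exact: loop_vertex_interior.
- exact: loop_vertex_separated.
- exact: loop_vertex_turn.
- by case: (@loop_vertex_start R).
- by case: (@loop_vertex_start R).
- by case: (@loop_vertex_start R).
- exact: loop_vertex_upper.
Qed.
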